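(* Let $\alpha,n$ be positive integers with $n>\alpha$ and $n\ge2$. For integers $k\ge0$ set $\mathscr{H}^\alpha_{n,k}=|R^{\alpha\text{-Gib}}(n,k)|$, $\mathscr{G}^\alpha_{n,k}=n^{k\bmod 2}\,\overline{G}^{\alpha,1}_k(n^2)$, and $\mathscr{A}^\alpha_{n,k}=A^{(\alpha;n)}_k(1)$. Then for each $\mathscr{X}\in\{\mathscr{A},\mathscr{G},\mathscr{H}\}$: $\mathscr{X}^\alpha_{n,0}=\alpha$, $\mathscr{X}^\alpha_{n,1}=n$, and $\mathscr{X}^\alpha_{n,k}=n\mathscr{X}^\alpha_{n,k-1}-\mathscr{X}^\alpha_{n,k-2}$ for $k\ge2$. If $n=2$ (so necessarily $\alpha=1$), then $\mathscr{X}^1_{2,k}=k+1$ for all $k\ge0$. If $n>2$, then for all $k\ge0$ \[\mathscr{X}^\alpha_{n,k}=\frac{r_2^{\,k}(n-\alpha r_1)-r_1^{\,k}(n-\alpha r_2)}{r_2-r_1},\] where $r_2$ and $r_1$ are respectively the larger and the smaller of the two distinct real roots of $x^2-nx+1$.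
   Context: For positive integers $\alpha,n$ and $k\ge1$, $R^{\alpha\text{-Gib}}(n,k)$ is the set of integer $k$-tuples $T=(T_1,\ldots,T_k)$ with (1) $T_j\in\{(j-1)n+1,\ldots,jn\}$ for all $j$; (2) $T_{j+1}\neq T_j+1$ for $1\le j\le k-1$; (3) $(T_1,T_k)\neq(i,nk-i+1)$ for $1\le i\le\alpha-1$; by convention $R^{\alpha\text{-Gib}}(n,0)$ is an $\alpha$-element set. Sign-alternating Gibonacci polynomials: $\overline{G}^{\alpha,1}_0(x)=\alpha$, $\overline{G}^{\alpha,1}_1(x)=1$, $\overline{G}^{\alpha,1}_k(x)=x^{(k-1)\bmod 2}\overline{G}^{\alpha,1}_{k-1}(x)-\overline{G}^{\alpha,1}_{k-2}(x)$ for $k\ge2$. Symmetric $(\alpha;n)$-Gibonacci triangle: with $\mathcal{I}_{n,k}=\{-k(n-1),-k(n-1)+2,\ldots,k(n-1)\}$, define $a_{k,r}$ by $a_{k,r}=0$ for $r\notin\mathcal{I}_{n,k}$, $a_{0,0}=\alpha$, $a_{1,r}=1$ for $r\in\mathcal{I}_{n,1}$, and $a_{k,r}=\left(\sum_{s\in\mathcal{I}_{n,1}}a_{k-1,r+s}\right)-a_{k-2,r}$ for $k\ge2$; then $A^{(\alpha;n)}_k(q)=\sum_{r\in\mathcal{I}_{n,k}}a_{k,r}q^{\frac12(k(n-1)-r)}$, so $A^{(\alpha;n)}_k(1)$ is the sum of the entries of row $k$.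
   Formalization: Condition (3) on (T_1,T_k) is imposed only for k≥2; read literally at k=1 it would delete T_1=(n+1)/2 when n is odd and 2α≥n+3 (e.g. n=5, α=4 gives |R(5,1)|=4), contradicting the claimed value n for H at k=1. *)

(* Defs.v *)
From HB Require Import structures.
From mathcomp Require Import all_boot all_order all_algebra.
From mathcomp Require Import reals.

Set Implicit Arguments.
Unset Strict Implicit.
Unset Printing Implicit Defensive.

Import Order.TTheory GRing.Theory Num.Theory.

Local Open Scope ring_scope.

(* T_j is tnth T (j - 1).  Every admissible entry lies between 1 and n * k, so
   tuples over 'I_(n * k).+1 contain all of them.

   The conjunct 1 < k: the last condition forbids a pair (first entry, last
   entry), and is imposed only when these are two different positions.  Applied
   to k = 1 it would delete T_1 = (n + 1) / 2 whenever n is odd and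
   n + 3 <= 2 * alpha, leaving n - 1 tuples (e.g. n = 5, alpha = 4) and
   contradicting the count n required for k = 1. *)
Definition is_gib (alpha n k' : nat)
    (T : (k'.+1).-tuple 'I_(n * k'.+1).+1) : bool :=
  let k := k'.+1 in
  [&& [forall j : 'I_k, (j * n + 1 <= tnth T j <= j.+1 * n)%N],
      [forall i : 'I_k, forall j : 'I_k,
         (j == i.+1 :> nat) ==> (tnth T j != (tnth T i + 1)%N :> nat)] &
      (1 < k)%N ==>
        [forall i : 'I_alpha, (1 <= i)%N ==>
           ((tnth T ord0 : nat, tnth T ord_max : nat)
              != (i : nat, n * k - i + 1)%N)]].

Definition R_gib (alpha n k : nat) : finType :=
  match k with
  | 0 => 'I_alpha
  | k'.+1 => {T : (k'.+1).-tuple 'I_(n * k'.+1).+1 | is_gib alpha T}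
  end.

Fixpoint Gbar (alpha k : nat) {struct k} : {poly int} :=
  match k with
  | 0 => (alpha%:Z)%:P
  | k1.+1 =>
    match k1 with
    | 0 => 1
    | k2.+1 => 'X^(k1 %% 2) * Gbar alpha k1 - Gbar alpha k2
    end
  end.

Definition triI (n k : nat) : seq int :=
  [seq (2 * i)%N%:Z - (k * (n - 1))%N%:Z | i <- iota 0 (k * (n - 1)).+1%N].

Fixpoint tri (alpha n k : nat) (r : int) {struct k} : int :=
  if r \in triI n k then
    match k with
    | 0 => alpha%:Z
    | k1.+1 =>
      match k1 with
      | 0 => 1
      | k2.+1 => \sum_(s <- triI n 1) tri alpha n k1 (r + s) - tri alpha n k2 r
      end
    end
  else 0.

(* The exponent (k(n-1) - r)/2 is exact and nonnegative for r in triI n k. *)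
Definition Apoly (alpha n k : nat) : {poly int} :=
  \sum_(r <- triI n k)
     tri alpha n k r *: 'X^(`|(k * (n - 1))%N%:Z - r|%N %/ 2).

Definition scrH (alpha n k : nat) : int := #|R_gib alpha n k|%:Z.

Definition scrG (alpha n k : nat) : int :=
  n%:Z ^+ (k %% 2) * (Gbar alpha k).[n%:Z ^+ 2].

Definition scrA (alpha n k : nat) : int := (Apoly alpha n k).[1].

(* Main.v *)
(* All three sequences satisfy X_0 = alpha, X_1 = n, X_{k+2} = n X_{k+1} - X_k.
   For the tuples: reducing entries modulo n turns R(n,k) into words over
   {0, ..., n-1} that avoid the factor (n-1)0 and the pairs (i-1, n-i) of
   (first, last) letters, 1 <= i < alpha.  If W_k counts the words avoiding the
   factor, then W_{k+2} = n W_{k+1} - W_k.  Since i-1 <> n-1 and n-i <> 0, a word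
   with forbidden ends has a free middle, so H_{k+2} = W_{k+2} - (alpha-1) W_k,
   which inherits the recurrence. *)

Require Import Defs.
From HB Require Import structures.
From mathcomp Require Import all_boot all_order all_algebra.
From mathcomp Require Import reals.
From mathcomp Require Import zify ring lra.

Set Implicit Arguments.
Unset Strict Implicit.
Unset Printing Implicit Defensive.

Import Order.TTheory GRing.Theory Num.Theory.

Local Open Scope ring_scope.

(** * The recurrence and its closed forms *)

Definition second_order_rec (alpha n : nat) (X : nat -> int) :=
  [/\ X 0%N = alpha%:Z, X 1%N = n%:Z
    & forall k : nat, X k.+2 = n%:Z * X k.+1 - X k].

(** Clearing the denominator [r2 - r1] keeps the identity valid in any commutative ring. Since r1 +
    r2 = n and r1 r2 = 1, the powers of each root satisfy the recurrence, and two initial values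
    settle the rest. *)
Lemma second_order_rec_binet (R : comPzRingType) (alpha n : nat) (X : nat -> int)
    (r1 r2 : R) :
    r1 + r2 = n%:R -> r1 * r2 = 1 -> second_order_rec alpha n X ->
  forall k, (X k)%:~R * (r2 - r1) =
    r2 ^+ k * (n%:R - alpha%:R * r1) - r1 ^+ k * (n%:R - alpha%:R * r2).
Proof.
move=> sum_r prod_r [X0 X1 XS] k.
suff [] : (X k)%:~R * (r2 - r1) =
    r2 ^+ k * (n%:R - alpha%:R * r1) - r1 ^+ k * (n%:R - alpha%:R * r2)
  /\ (X k.+1)%:~R * (r2 - r1) =
    r2 ^+ k.+1 * (n%:R - alpha%:R * r1) - r1 ^+ k.+1 * (n%:R - alpha%:R * r2)
  by [].
elim: k => [|k [IHk IHk1]].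
  by rewrite X0 X1 !expr0 !expr1 -!pmulrn; split; ring: prod_r.
split=> //.
rewrite XS rmorphB rmorphM /= mulrBl -mulrA IHk IHk1 -pmulrn !exprS -sum_r.
by ring: prod_r.
Qed.

Lemma second_order_rec_n2 (X : nat -> int) :
  second_order_rec 1 2 X -> forall k, X k = (k + 1)%N%:Z.
Proof.
move=> [X0 X1 XS] k.
suff [] : X k = (k + 1)%N%:Z /\ X k.+1 = (k.+1 + 1)%N%:Z by [].
elim: k => [|k [IHk IHk1]]; first by rewrite X0 X1.
by split=> //; rewrite XS IHk IHk1; lia.
Qed.

(** * Gibonacci polynomials evaluated at the square of n *)

Lemma scrG_rec (alpha n : nat) : second_order_rec alpha n (scrG alpha n).
Proof.
split=> [||k]; rewrite /scrG.
- by rewrite expr0 mul1r hornerC.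
- by rewrite hornerC mulr1.
have -> : Gbar alpha k.+2 = 'X^(k.+1 %% 2) * Gbar alpha k.+1 - Gbar alpha k by [].
rewrite hornerD hornerN hornerM hornerXn mulrBr.
have -> : (k.+2 %% 2 = k %% 2)%N by lia.
(* The powers of n agree because [k %% 2 + k.+1 %% 2 = 1]. *)
congr (_ - _); rewrite !mulrA -exprM -exprD -exprS; congr (_ ^+ _ * _).
lia.
Qed.

(** * Row sums of the Gibonacci triangle *)

Lemma uniq_triI (n k : nat) : uniq (triI n k).
Proof. by rewrite map_inj_uniq ?iota_uniq // => i j; lia. Qed.

Lemma size_triI (n k : nat) : size (triI n k) = (k * (n - 1)).+1%N.
Proof. by rewrite size_map size_iota. Qed.

Lemma mem_triI (n k : nat) (r : int) :
  reflect (exists2 i : nat, (i <= k * (n - 1))%N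
             & r = (2 * i)%N%:Z - (k * (n - 1))%N%:Z)
          (r \in triI n k).
Proof.
apply: (iffP mapP) => -[i Hi ->]; exists i => //; move: Hi; rewrite mem_iota; lia.
Qed.

Lemma tri_out (alpha n k : nat) (r : int) :
  r \notin triI n k -> tri alpha n k r = 0.
Proof. by case: k => [|k] /negbTE rI; rewrite [tri _ _ _ _]/= rI. Qed.

(** Entries vanish outside [triI n k], so enlarging the range adds only zeros. This absorbs the
    longer and translated ranges that the recurrence produces. *)
Lemma sum_tri_sup (alpha n k : nat) (s : seq int) :
    uniq s -> {subset triI n k <= s} ->
  \sum_(r <- s) tri alpha n k r = \sum_(r <- triI n k) tri alpha n k r.
Proof.
move=> uniq_s sub_s.
rewrite (bigID (mem (triI n k))) /= [X in _ + X]big1 ?addr0; last first.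
  by move=> r /tri_out.
rewrite -big_filter; apply: perm_big; apply: uniq_perm.
- exact: filter_uniq.
- exact: uniq_triI.
by move=> r; rewrite mem_filter andb_idr //; apply: sub_s.
Qed.

Lemma scrAE (alpha n k : nat) :
  scrA alpha n k = \sum_(r <- triI n k) tri alpha n k r.
Proof.
rewrite /scrA /Apoly horner_sum; apply: eq_bigr => r _.
by rewrite hornerZ hornerXn expr1n mulr1.
Qed.

(** After exchanging the sums, each of the n shifts s sums row k+1 over the translate of
    [triI n k.+2] by s. This translate still covers [triI n k.+1], so every shift contributes one
    full row sum. *)
Lemma scrA_rec (alpha n : nat) : (0 < n)%N ->
  second_order_rec alpha n (scrA alpha n).
Proof.
move=> n_gt0; split=> [||k]; rewrite !scrAE.
- by rewrite /triI /= big_seq1.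
- rewrite (eq_big_seq (fun=> 1)) => [|r rI]; last by rewrite [LHS]/= rI.
  by rewrite big_const_seq count_predT size_triI iter_addr_0 pmulrn; lia.
transitivity (\sum_(r <- triI n k.+2)
    (\sum_(s <- triI n 1) tri alpha n k.+1 (r + s) - tri alpha n k r)).
  by apply: eq_big_seq => r rI; rewrite [LHS]/= rI.
rewrite big_split /= sumrN; congr (_ - _); last first.
  apply: sum_tri_sup; first exact: uniq_triI.
  move=> _ /mem_triI[i le_i ->]; apply/mem_triI.
  (* 2i - k(n-1) = 2(i + n - 1) - (k+2)(n-1). *)
  by exists (i + (n - 1))%N; nia.
rewrite exchange_big /=.
rewrite (eq_big_seq (fun=> \sum_(r <- triI n k.+1) tri alpha n k.+1 r)).
  rewrite big_const_seq count_predT size_triI iter_addr_0 -mulr_natl natz.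
  by congr (Posz _ * _); lia.
move=> s /mem_triI[j le_j ->].
set c := (_ - _ : int).
rewrite -(big_map (fun r => r + c) predT (tri alpha n k.+1)).
apply: sum_tri_sup; first by rewrite map_inj_uniq ?uniq_triI //; apply: addIr.
move=> _ /mem_triI[i le_i ->]; apply/mapP.
exists ((2 * i)%N%:Z - (k.+1 * (n - 1))%N%:Z - c); last by rewrite subrK.
(* Here c = 2j - (n-1) with j <= n-1, so the natural-number subtraction is not truncated. *)
by apply/mem_triI; exists (i + (n - 1) - j)%N; rewrite /c; nia.
Qed.

(** * Counting tuples by their first or last entry *)

Lemma card_tupleS (T : finType) (k : nat) (P : pred (seq T)) :
  #|[pred t : k.+1.-tuple T | P t]|
  = (\sum_(a : T) #|[pred t : k.-tuple T | P (a :: t)]|)%N.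
Proof.
under eq_bigr do rewrite -sum1_card.
rewrite -sum1_card pair_big_dep /=.
rewrite (reindex (fun p : T * k.-tuple T => [tuple of p.1 :: p.2])) /=.
  by apply: eq_bigl => -[a t].
exists (fun t => (thead t, [tuple of behead t])) => [[a t] _|t _] /=.
  by congr pair; apply: val_inj.
by rewrite -tuple_eta.
Qed.

Lemma card_tuple_rev (T : finType) (k : nat) (P : pred (seq T)) :
  #|[pred t : k.-tuple T | P t]| = #|[pred t : k.-tuple T | P (rev t)]|.
Proof.
rewrite -!sum1_card (reindex_inj (h := fun t : k.-tuple T => [tuple of rev t])) //.
by move=> s t /(congr1 val)/= /(can_inj revK)/val_inj.
Qed.

(** Reversal exchanges the two ends; together with [card_tupleS] this allows both end letters of a
    word to be fixed. *)
Lemma card_tupleS_rcons (T : finType) (k : nat) (P : pred (seq T)) :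
  #|[pred t : k.+1.-tuple T | P t]|
  = (\sum_(b : T) #|[pred t : k.-tuple T | P (rcons t b)]|)%N.
Proof.
rewrite card_tuple_rev (card_tupleS _ (fun s => P (rev s))).
apply: eq_bigr => b _.
rewrite [RHS](card_tuple_rev _ (fun s => P (rcons s b))).
by apply: eq_card => t; rewrite !inE rev_cons.
Qed.

(** * Words avoiding the factor m 0, where n = m + 1 *)

Section Words.

Variable m : nat.

Definition allowed : rel 'I_m.+1 :=
  fun a b => ~~ ((a == ord_max) && (b == ord0)).

Definition nb_words (k : nat) : nat :=
  #|[pred t : k.-tuple 'I_m.+1 | sorted allowed t]|.

Lemma sorted_allowed_cons (a : 'I_m.+1) (s : seq 'I_m.+1) :
  a != ord_max -> sorted allowed (a :: s) = sorted allowed s.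
Proof. by case: s => //= b s /negbTE a_max; rewrite {1}/allowed a_max. Qed.

Lemma sorted_allowed_rcons (b : 'I_m.+1) (s : seq 'I_m.+1) :
  b != ord0 -> sorted allowed (rcons s b) = sorted allowed s.
Proof.
case: s => //= a s /negbTE b0.
by rewrite rcons_path {2}/allowed b0 andbF andbT.
Qed.

Lemma nb_words0 : nb_words 0 = 1%N.
Proof.
rewrite -[RHS](expn0 #|'I_m.+1|) -card_tuple; apply: eq_card => t.
by rewrite !inE tuple0.
Qed.

Lemma nb_words1 : nb_words 1 = m.+1.
Proof.
transitivity (#|'I_m.+1| ^ 1)%N; last by rewrite expn1 card_ord.
rewrite -card_tuple.
by apply: eq_card => -[[|a [|]]].
Qed.

(* Prepending the largest letter fails exactly on the words starting with 0. *)
Lemma nb_wordsSS (k : nat) : (0 < m)%N ->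
  (nb_words k.+2 + nb_words k = m.+1 * nb_words k.+1)%N.
Proof.
move=> m_gt0.
have max0 : (ord0 : 'I_m.+1) != ord_max by rewrite -val_eqE /=; lia.
have cons_words a : a != ord_max ->
    #|[pred t : k.+1.-tuple 'I_m.+1 | sorted allowed (a :: t)]| = nb_words k.+1.
  by move=> a_max; apply: eq_card => t; rewrite !inE sorted_allowed_cons.
rewrite {1}/nb_words card_tupleS (bigD1 ord_max) //=.
under eq_bigr => a a_max do rewrite (cons_words a a_max).
rewrite sum_nat_const cardC1 card_ord /= addnAC mulSn; congr (_ + _)%N.
(* As m > 0, the letter 0 may be prepended to any admissible word, so [nb_words k] also counts the
   admissible words of length k+1 that start with 0. *)
have -> : nb_words k = #|[pred t : k.+1.-tuple 'I_m.+1 |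
                          (head ord0 t == ord0) && sorted allowed t]|.
  rewrite (card_tupleS _ (fun s => (head ord0 s == ord0) && sorted allowed s)).
  rewrite (bigD1 ord0) //= big1 => [|a /negbTE a0]; last first.
    by apply: eq_card0 => t; rewrite !inE /= a0.
  rewrite addn0; apply: eq_card => t.
  by rewrite !inE /= -(sorted_allowed_cons t max0).
rewrite /nb_words -[RHS](cardID [pred t | head ord0 (val t) == ord0]) addnC.
congr (_ + _)%N; apply: eq_card => t; rewrite !inE /= [RHS]andbC //.
by case: t => -[//|a s] st; rewrite /= {1}/allowed eqxx andbC.
Qed.

(* The pairs (i - 1, n - i) with 1 <= i < alpha, where n = m + 1. *)
Definition bad_ends (alpha : nat) (a b : 'I_m.+1) : bool :=
  (a + b == m)%N && (a.+1 < alpha)%N.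

(** Each [a] has the single partner [rev_ord a], that is m - a, so only the letters with a + 1 <
    alpha are counted. *)
Lemma card_bad_ends (alpha : nat) : (0 < alpha <= m)%N ->
  (\sum_(a : 'I_m.+1) \sum_(b : 'I_m.+1) bad_ends alpha a b = alpha.-1)%N.
Proof.
move=> alpha_le.
transitivity (\sum_(a < m.+1) (a < alpha.-1))%N.
  apply: eq_bigr => a _; rewrite (bigD1 (rev_ord a)) //= big1 => [|b b_a].
    by rewrite /bad_ends /=; have := ltn_ord a; lia.
  rewrite /bad_ends; move: b_a; rewrite -val_eqE /=.
  by have := ltn_ord a; have := ltn_ord b; lia.
rewrite -(big_mkord xpredT (fun a => (a < alpha.-1) : nat)).
rewrite (big_cat_nat (n := alpha.-1)) //=; last by lia.
rewrite [X in (_ + X)%N]big_nat_cond [X in (_ + X)%N]big1 => [|a]; last by lia.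
rewrite big_nat_cond (eq_bigr (fun=> 1%N)) => [|a]; last by lia.
by rewrite -big_nat_cond sum_nat_const_nat; lia.
Qed.


Lemma card_words_bad_ends (alpha k : nat) : (0 < alpha <= m)%N ->
  #|[pred t : k.+2.-tuple 'I_m.+1 | sorted allowed t
       && bad_ends alpha (head ord0 t) (last ord0 t)]|
  = (alpha.-1 * nb_words k)%N.
Proof.
move=> alpha_le.
rewrite (card_tupleS _ (fun s => sorted allowed s
  && bad_ends alpha (head ord0 s) (last ord0 s))).
rewrite -(card_bad_ends alpha_le) big_distrl /=; apply: eq_bigr => a _.
rewrite (card_tupleS_rcons _ (fun s => path allowed a s
  && bad_ends alpha a (last a s))).
rewrite big_distrl /=; apply: eq_bigr => b _.
have [ab|/negbTE ab] := boolP (bad_ends alpha a b); last first.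
  by rewrite mul0n; apply: eq_card0 => t; rewrite !inE last_rcons ab andbF.
rewrite mul1n; apply: eq_card => t; rewrite !inE last_rcons ab andbT.
(* From a + 1 < alpha <= m follows a < m, hence b = m - a > 0: neither end constrains its
   neighbour. *)
have/andP[a_max b0] : (a != ord_max) && (b != ord0).
  by move: ab; rewrite /bad_ends -!val_eqE /=; lia.
by rewrite -/(sorted allowed (a :: _)) sorted_allowed_cons ?sorted_allowed_rcons.
Qed.

(** * Encoding of Gibonacci tuples as words *)

Section Encoding.

Variables (alpha k : nat).

(* T_j = (j - 1) n + t_j + 1 with letters t_j in {0, ..., n - 1}. *)
Definition tuple_of_word (t : k.+1.-tuple 'I_m.+1) :
    k.+1.-tuple 'I_(m.+1 * k.+1).+1 :=
  [tuple inord (j * m.+1 + tnth t j + 1) | j < k.+1].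

Definition word_of_tuple (T : k.+1.-tuple 'I_(m.+1 * k.+1).+1) :
    k.+1.-tuple 'I_m.+1 :=
  [tuple inord (tnth T j - j * m.+1 - 1) | j < k.+1].

Lemma tnth_tuple_of_word (t : k.+1.-tuple 'I_m.+1) (j : 'I_k.+1) :
  tnth (tuple_of_word t) j = (j * m.+1 + tnth t j + 1)%N :> nat.
Proof.
rewrite tnth_mktuple inordK //.
by have := ltn_ord j; have := ltn_ord (tnth t j); nia.
Qed.

Lemma tuple_of_wordK : cancel tuple_of_word word_of_tuple.
Proof.
move=> t; apply: eq_from_tnth => j.
rewrite tnth_mktuple tnth_tuple_of_word; apply: val_inj => /=.
by rewrite inordK; have := ltn_ord (tnth t j); lia.
Qed.

(** The range condition puts every decoded letter in {0, ..., m}, so neither truncated subtraction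
    nor [inord] loses information. *)
Lemma word_of_tupleK (T : k.+1.-tuple 'I_(m.+1 * k.+1).+1) :
  is_gib alpha T -> tuple_of_word (word_of_tuple T) = T.
Proof.
case/and3P => /forallP T_range _ _; apply: eq_from_tnth => j.
apply: val_inj; rewrite [LHS]tnth_tuple_of_word tnth_mktuple /=.
have := T_range j; move: (nat_of_ord (tnth T j)) => x x_range.
by rewrite inordK; nia.
Qed.

(** Consecutive entries differ by m + 1 + t_{j+1} - t_j, which equals 1 exactly when t_j = m and
    t_{j+1} = 0. The pair (i, nk - i + 1) of end entries becomes the pair (i - 1, n - i) of end
    letters. *)
Lemma is_gib_tuple_of_word (t : k.+1.-tuple 'I_m.+1) : (alpha <= m.+1)%N ->
  is_gib alpha (tuple_of_word t) =
  sorted allowed t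
    && ((0 < k)%N ==> ~~ bad_ends alpha (head ord0 t) (last ord0 t)).
Proof.
move=> alpha_le; rewrite /is_gib.
have -> /= : [forall j : 'I_k.+1,
    (j * m.+1 + 1 <= tnth (tuple_of_word t) j <= j.+1 * m.+1)%N].
  apply/forallP => j; rewrite tnth_tuple_of_word.
  by have := ltn_ord (tnth t j); nia.
congr (_ && _).
  apply/forallP/(sortedP ord0) => [t_ok i|t_ok i].
    rewrite size_tuple => lt_i.
    have /forallP/(_ (Ordinal lt_i))/implyP/(_ (eqxx _)) :=
      t_ok (Ordinal (ltnW lt_i)).
    rewrite !tnth_tuple_of_word !(tnth_nth ord0) /= /allowed -!val_eqE /=.
    by lia.
  apply/forallP => j; apply/implyP => /eqP j_i.
  have := t_ok i; rewrite size_tuple -j_i ltn_ord => /(_ isT).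
  rewrite !tnth_tuple_of_word !(tnth_nth ord0) /= /allowed -!val_eqE /= j_i.
  by have := ltn_ord (nth ord0 t i); lia.
rewrite ltnS; congr (_ ==> _).
have -> : head ord0 t = tnth t ord0 by rewrite (tnth_nth ord0) nth0.
have -> : last ord0 t = tnth t ord_max.
  by rewrite (tnth_nth ord0) -nth_last size_tuple.
set a := tnth t ord0; set b := tnth t ord_max.
have [lt_a lt_b] := (ltn_ord a, ltn_ord b).
apply/forallP/idP => [t_ok|t_ok i].
  apply/negP => /andP[/eqP ab lt_alpha].
  (* The violated index is i = a + 1. *)
  have := t_ok (Ordinal lt_alpha).
  rewrite !tnth_tuple_of_word -/a -/b xpair_eqE /= => /negP; apply.
  by nia.
apply/implyP => i_gt0; rewrite !tnth_tuple_of_word -/a -/b xpair_eqE /=.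
apply: contra t_ok => /andP[/eqP a_i /eqP b_i].
by have := ltn_ord i; rewrite /bad_ends; nia.
Qed.

Lemma card_R_gib : (alpha <= m.+1)%N ->
  #|R_gib alpha m.+1 k.+1| = #|[pred t : k.+1.-tuple 'I_m.+1 | sorted allowed t
    && ((0 < k)%N ==> ~~ bad_ends alpha (head ord0 t) (last ord0 t))]|.
Proof.
move=> alpha_le; rewrite card_sig -!sum1_card.
rewrite (reindex_onto tuple_of_word word_of_tuple) => [|T]; last first.
  exact: word_of_tupleK.
apply: eq_bigl => t.
by rewrite tuple_of_wordK eqxx andbT inE is_gib_tuple_of_word.
Qed.

End Encoding.

End Words.

(** * Recurrence for the number of Gibonacci tuples *)

Lemma scrH_rec (alpha n : nat) : (0 < alpha < n)%N ->
  second_order_rec alpha n (scrH alpha n).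
Proof.
case: n => [|m]; first by rewrite ltn0 andbF.
rewrite ltnS => alpha_m.
have alpha_le : (alpha <= m.+1)%N by lia.
have H1 : #|R_gib alpha m.+1 1| = m.+1.
  rewrite card_R_gib // -[RHS]nb_words1; apply: eq_card => t.
  by rewrite !inE andbT.
have HSS k : (#|R_gib alpha m.+1 k.+2| + alpha.-1 * nb_words m k
              = nb_words m k.+2)%N.
  rewrite card_R_gib // -(card_words_bad_ends k alpha_m) /nb_words.
  rewrite -[RHS](cardID
    [pred t | bad_ends alpha (head ord0 (val t)) (last ord0 (val t))]) addnC.
  by congr (_ + _)%N; apply: eq_card => t; rewrite !inE // andbC.
have W k := @nb_wordsSS m k ltac:(lia).
have [W0 W1] := (nb_words0 m, nb_words1 m).
split; rewrite /scrH ?H1 //; first by rewrite card_ord.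
(* [HSS] starts at length 2: length 0 is a convention and length 1 has no end condition, so the
   first two instances use these values directly. *)
case=> [|[|k]].
- by have := HSS 0%N; have := W 0%N; rewrite H1 card_ord W0 W1; nia.
- by have := HSS 0%N; have := HSS 1%N; have := W 1%N; rewrite H1 W0 W1; nia.
by have := HSS k; have := HSS k.+1; have := HSS k.+2;
   have := W k; have := W k.+2; nia.
Qed.

(** * Real roots and the final statement *)

Lemma monic_quadratic_roots (R : rcfType) (c : R) : 2 < c ->
  exists r1 r2 : R, [/\ r1 < r2, r1 + r2 = c & r1 * r2 = 1].
Proof.
move=> c_gt2; set d := Num.sqrt (c ^+ 2 - 4).
have d_gt0 : 0 < d by rewrite sqrtr_gt0; nra.
have d2 : d ^+ 2 = c ^+ 2 - 4 by rewrite sqr_sqrtr //; nra.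
by exists ((c - d) / 2), ((c + d) / 2); split; [lra | field | field: d2].
Qed.

Theorem theorem5p4 (R : realType) (alpha n : nat)
    (alpha_gt0 : (0 < alpha)%N) (alpha_lt_n : (alpha < n)%N)
    (n_ge2 : (2 <= n)%N)
    (X : nat -> int)
    (hX : X = scrA alpha n \/ X = scrG alpha n \/ X = scrH alpha n) :
  [/\ X 0%N = alpha%:Z,
      X 1%N = n%:Z,
      (forall k : nat, (2 <= k)%N ->
         X k = n%:Z * X (k - 1)%N - X (k - 2)%N),
      (n = 2%N -> alpha = 1%N /\ forall k : nat, X k = (k + 1)%N%:Z)
    & ((2 < n)%N ->
         exists r1 r2 : R,
           [/\ r1 < r2,
               (forall x : R,
                  root ('X^2 - n%:R *: 'X + 1) x <-> x = r1 \/ x = r2)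
             & forall k : nat,
                 (X k)%:~R =
                   (r2 ^+ k * (n%:R - alpha%:R * r1)
                    - r1 ^+ k * (n%:R - alpha%:R * r2)) / (r2 - r1)])].
Proof.
have rec_X : second_order_rec alpha n X.
  case: hX => [|[]] ->.
  - by apply: scrA_rec; lia.
  - exact: scrG_rec.
  - by apply: scrH_rec; lia.
have [X0 X1 XS] := rec_X; split=> //.
- by case=> [|[|k]] // _; rewrite XS subn1 subn2.
- move=> n2; have alpha1 : alpha = 1%N by lia.
  by split=> //; apply: second_order_rec_n2; rewrite n2 alpha1 in rec_X.
move=> n_gt2.
have [|r1 [r2 [lt_r sum_r prod_r]]] := @monic_quadratic_roots R n%:R.
  by rewrite (ltr_nat R 2 n).
exists r1, r2; split=> // [x|k].
  (* Sum and product of the roots give the factorization of the quadratic. *)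
  have -> : root ('X^2 - n%:R *: 'X + 1) x = ((x - r1) * (x - r2) == 0).
    rewrite rootE !hornerE -sum_r -prod_r; congr (_ == _); ring.
  rewrite mulf_eq0 !subr_eq0; split=> [/orP[]/eqP|[]->]; rewrite ?eqxx ?orbT; auto.
rewrite -(second_order_rec_binet sum_r prod_r rec_X) mulfK //.
by rewrite subr_eq0 gt_eqF.
Qed.
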